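(* Let $\sum_{n=0}^{\infty} a_n$ be a series of non-zero real numbers and let $p\in(0,\infty)$. (1) If $\rho_{\mathrm{mean}}$ (with exponent $p$) exists and $\rho_{\mathrm{mean}}<1$, then the series $\sum_{n=0}^\infty a_n$ is convergent. (2) If $\rho_{\mathrm{ratio}}$ exists, then $\rho_{\mathrm{mean}}$ and $\rho_{\mathrm{root}}$ exist and $\rho_{\mathrm{mean}}=\rho_{\mathrm{root}}=\rho_{\mathrm{ratio}}$.
   Context: For a series $\sum_{n=0}^\infty a_n$ of non-zero real numbers and an exponent $p\in(0,\infty)$, define $$\rho_{\mathrm{ratio}}=\lim_{n\to\infty}\frac{|a_{n+1}|}{|a_n|},\qquad \rho_{\mathrm{root}}=\lim_{n\to\infty}\sqrt[n]{|a_n|},\qquad \rho_{\mathrm{mean}}=\lim_{N\to\infty}\sqrt[p]{\frac{1}{N}\sum_{n=1}^{N}\left|\frac{a_n}{a_{n-1}}\right|^p},$$ each whenever the corresponding limit exists, finite or infinite (i.e. in $[0,\infty]$). *)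

(* Defs.v *)
From Stdlib Require Import Reals.
From Coquelicot Require Import Coquelicot.
Open Scope R_scope.

(* Roots are written with [Rpower x y = exp (y * ln x)], which is the real power
   for [x > 0].  For a series with non-zero terms every base below is positive,
   except in [mean_seq p a 0]; the index 0 of [root_seq] and [mean_seq]
   is junk and does not affect the limits. *)

Definition ratio_seq (a : nat -> R) (n : nat) : R :=
  Rabs (a (S n)) / Rabs (a n).

Definition root_seq (a : nat -> R) (n : nat) : R :=
  Rpower (Rabs (a n)) (/ INR n).

Definition mean_seq (p : R) (a : nat -> R) (N : nat) : R :=
  Rpower (1 / INR N *
          sum_n_m (fun n => Rpower (Rabs (a n / a (n - 1)%nat)) p) 1 N)
         (/ p).

(* [Lim_seq] is total: the values below are meaningful only together with
   [ex_lim_seq], which allows infinite limits. *)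
Definition rho_ratio (a : nat -> R) : Rbar := Lim_seq (ratio_seq a).
Definition rho_root (a : nat -> R) : Rbar := Lim_seq (root_seq a).
Definition rho_mean (p : R) (a : nat -> R) : Rbar := Lim_seq (mean_seq p a).

(* Main.v *)
Require Import Defs.
From Stdlib Require Import Reals Lra Lia.
From Coquelicot Require Import Coquelicot.
Open Scope R_scope.

(** Put [t n = ln |a n / a (n-1)|].  Since the consecutive quotients telescope,
    [ln |a N| = ln |a 0| + (t 1 + ... + t N)], so everything can be read off
    from averages of [t]: up to the vanishing term [ln |a 0| / N], the logarithm
    of the [N]-th root of [|a N|] is the arithmetic mean of [t 1], ..., [t N],
    while the power mean of the quotients is the quasi-arithmetic mean of the
    same numbers for the function [fun s => exp (p * s)].

    Convergence: by the inequality of arithmetic and geometric means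
    ([sum_ln_le]), the [N]-th power mean [m N] of the quotients bounds their
    geometric mean, that is [ln |a N| <= ln |a 0| + N * ln (m N)].  If [m N] has
    a limit less than 1, it is eventually below some [q < 1], hence
    [|a N| <= |a 0| * q ^ N], and the series is dominated by a geometric one.

    Equality of the limits: if the quotients converge to [L] in [[0, oo]], then
    [t] converges to the extended real [tau] with [exp tau = L].  Cesaro's
    theorem, valid also for infinite limits ([is_lim_seq_average]), says that
    averaging preserves limits.  Averaging [t] gives the root limit, and
    averaging [exp (p * t n)] gives the mean limit; both are [exp tau].  The
    cases [L = 0] and [L = oo] need no separate treatment, because [exp] is an
    order isomorphism from the extended reals onto [[0, oo]]
    ([is_lim_seq_exp], [is_lim_seq_exp_inv], [Rbar_exp_surj]). *)

(** * Cesaro averages *)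

Definition average (u : nat -> R) (N : nat) : R :=
  1 / INR N * sum_n_m u 1 N.

Lemma sum_from1_S (u : nat -> R) (N : nat) :
  sum_n_m u 1 (S N) = sum_n_m u 1 N + u (S N) :> R.
Proof. apply (sum_n_Sm u 1 N); lia. Qed.

Lemma sum_from1_0 (u : nat -> R) : sum_n_m u 1 0 = 0 :> R.
Proof. apply (sum_n_m_zero u 1 0); lia. Qed.

Lemma INR_mult_average (u : nat -> R) (N : nat) :
  (0 < N)%nat -> INR N * average u N = sum_n_m u 1 N :> R.
Proof.
  intros HN. unfold average. field. apply not_0_INR. lia.
Qed.

Lemma average_opp (u : nat -> R) (N : nat) :
  average (fun n => - u n) N = - average u N.
Proof.
  unfold average.
  assert (H : sum_n_m (fun n => - u n) 1 N = - sum_n_m u 1 N :> R).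
  { induction N as [|N IH].
    - rewrite !sum_from1_0. ring.
    - rewrite !sum_from1_S, IH. ring. }
  rewrite H. ring.
Qed.

(** The finitely many terms that may lie below [c] change the sum by a bounded
    amount, which division by [N] makes smaller than [c - c']. *)
Lemma average_eventually_gt (u : nat -> R) (c c' : R) :
  eventually (fun n => c < u n) -> c' < c ->
  eventually (fun N => c' < average u N).
Proof.
  intros [K HK] Hc.
  assert (Hsum : forall j, sum_n_m u 1 K + c * INR j <= sum_n_m u 1 (K + j)).
  { induction j as [|j IH].
    - rewrite Nat.add_0_r. simpl. lra.
    - rewrite Nat.add_succ_r, sum_from1_S, S_INR.
      assert (c < u (S (K + j))) by (apply HK; lia). nra. }
  set (B := c * INR K - sum_n_m u 1 K) in *.
  assert (HN : eventually (fun N => B / (c - c') < INR N)).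
  { exact (proj2 (is_lim_seq_spec _ _) is_lim_seq_INR _). }
  destruct HN as [M HM].
  exists (S (K + M)). intros N HN.
  assert (Hpos : 0 < INR N) by (apply lt_0_INR; lia).
  assert (HB : B < (c - c') * INR N).
  { assert (H := HM N ltac:(lia)).
    apply (Rmult_lt_compat_l (c - c')) in H; [|lra].
    replace ((c - c') * (B / (c - c'))) with B in H by (field; lra). exact H. }
  assert (H := Hsum (N - K)%nat).
  replace (K + (N - K))%nat with N in H by lia.
  rewrite minus_INR in H by lia.
  apply (Rmult_lt_reg_l (INR N)); [exact Hpos|].
  rewrite INR_mult_average by lia.
  unfold B in HB. nra.
Qed.

Lemma average_eventually_lt (u : nat -> R) (c c' : R) :
  eventually (fun n => u n < c) -> c < c' ->
  eventually (fun N => average u N < c').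
Proof.
  intros [K HK] Hc.
  destruct (average_eventually_gt (fun n => - u n) (- c) (- c')) as [M HM].
  - exists K. intros n Hn. specialize (HK n Hn). lra.
  - lra.
  - exists M. intros N HN. specialize (HM N HN).
    rewrite average_opp in HM. lra.
Qed.

(** Cesaro's theorem.  The limit is allowed to be infinite: this is what covers
    ratios tending to 0 (logarithms tending to [-oo]) or to [oo]. *)
Lemma is_lim_seq_average (u : nat -> R) (l : Rbar) :
  is_lim_seq u l -> is_lim_seq (average u) l.
Proof.
  intros H. apply is_lim_seq_spec in H. apply is_lim_seq_spec.
  destruct l as [l| |]; simpl in *.
  - intros eps.
    destruct (H (pos_div_2 eps)) as [K HK]. simpl in HK.
    assert (He := cond_pos eps).
    assert (H1 : eventually (fun N => l - eps < average u N)).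
    { apply average_eventually_gt with (l - eps / 2); [|lra].
      exists K. intros n Hn. specialize (HK n Hn).
      apply Rabs_def2 in HK. lra. }
    assert (H2 : eventually (fun N => average u N < l + eps)).
    { apply average_eventually_lt with (l + eps / 2); [|lra].
      exists K. intros n Hn. specialize (HK n Hn).
      apply Rabs_def2 in HK. lra. }
    generalize (filter_and _ _ H1 H2). apply filter_imp.
    intros N [H3 H4]. apply Rabs_def1; lra.
  - intros M. apply average_eventually_gt with (M + 1); [apply H|lra].
  - intros M. apply average_eventually_lt with (M - 1); [apply H|lra].
Qed.

(** * The exponential on the extended reals *)

Definition Rbar_exp (x : Rbar) : Rbar :=
  match x with
  | Finite r => Finite (exp r)
  | p_infty => p_infty
  | m_infty => Finite 0
  end.

Lemma exp_le_mono (x y : R) : x <= y -> exp x <= exp y.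
Proof.
  intros [H|<-]; [left; now apply exp_increasing|right; reflexivity].
Qed.

Lemma Rbar_exp_surj (L : Rbar) :
  Rbar_le (Finite 0) L -> exists x, Rbar_exp x = L.
Proof.
  destruct L as [r| |]; simpl; intros H.
  - destruct H as [H|<-].
    + exists (Finite (ln r)). simpl. now rewrite exp_ln.
    + now exists m_infty.
  - now exists p_infty.
  - contradiction.
Qed.

Lemma is_lim_seq_exp (t : nat -> R) (x : Rbar) :
  is_lim_seq t x -> is_lim_seq (fun n => exp (t n)) (Rbar_exp x).
Proof.
  intros H. destruct x as [r| |]; simpl.
  - apply (is_lim_seq_continuous exp t r); [|exact H].
    apply derivable_continuous_pt, derivable_pt_exp.
  - apply is_lim_seq_le_p_loc with t; [|exact H].
    exists 0%nat. intros n _. assert (H1 := exp_ineq1_le (t n)). lra.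
  - apply is_lim_seq_spec in H. apply is_lim_seq_spec. intros eps.
    destruct (H (ln eps)) as [K HK]. exists K. intros n Hn.
    specialize (HK n Hn). apply exp_increasing in HK.
    rewrite exp_ln in HK by apply cond_pos.
    rewrite Rminus_0_r, Rabs_pos_eq; [exact HK|].
    left. apply exp_pos.
Qed.

Lemma is_lim_seq_exp_inv (t : nat -> R) (x : Rbar) :
  is_lim_seq (fun n => exp (t n)) (Rbar_exp x) -> is_lim_seq t x.
Proof.
  intros H. destruct x as [r| |]; simpl in H.
  - apply is_lim_seq_ext with (fun n => ln (exp (t n))).
    { intros n. apply ln_exp. }
    rewrite <- (ln_exp r).
    apply (is_lim_seq_continuous ln (fun n => exp (t n)) (exp r)); [|exact H].
    apply derivable_continuous_pt. exists (/ exp r).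
    apply derivable_pt_lim_ln, exp_pos.
  - apply is_lim_seq_spec in H. apply is_lim_seq_spec. intros M.
    destruct (H (exp M)) as [K HK]. exists K. intros n Hn.
    apply exp_lt_inv. apply HK, Hn.
  - apply is_lim_seq_spec in H. apply is_lim_seq_spec. intros M.
    destruct (H (mkposreal _ (exp_pos M))) as [K HK]. exists K. intros n Hn.
    apply exp_lt_inv. specialize (HK n Hn). simpl in HK.
    apply Rabs_def2 in HK. lra.
Qed.

Lemma Rbar_mult_inv_l (p : R) (x : Rbar) :
  0 < p -> Rbar_mult (Finite (/ p)) (Rbar_mult (Finite p) x) = x.
Proof.
  intros hp.
  assert (hi : 0 < / p) by now apply Rinv_0_lt_compat.
  destruct x as [r| |]; simpl.
  - f_equal. field. lra.
  - destruct (Rle_dec 0 p) as [h|h]; [|lra].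
    destruct (Rle_lt_or_eq_dec 0 p h); [|lra]. simpl.
    destruct (Rle_dec 0 (/ p)) as [h'|h']; [|lra].
    destruct (Rle_lt_or_eq_dec 0 (/ p) h'); [easy|lra].
  - destruct (Rle_dec 0 p) as [h|h]; [|lra].
    destruct (Rle_lt_or_eq_dec 0 p h); [|lra]. simpl.
    destruct (Rle_dec 0 (/ p)) as [h'|h']; [|lra].
    destruct (Rle_lt_or_eq_dec 0 (/ p) h'); [easy|lra].
Qed.

(** * Arithmetic, geometric and power means *)

Lemma average_pos (u : nat -> R) (N : nat) :
  (forall n, 0 < u n) -> (0 < N)%nat -> 0 < average u N.
Proof.
  intros Hu HN. unfold average. apply Rmult_lt_0_compat.
  - apply Rdiv_lt_0_compat; [lra|]. apply lt_0_INR, HN.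
  - destruct N as [|N]; [lia|]. clear HN.
    induction N as [|N IH]; rewrite sum_from1_S.
    + rewrite sum_from1_0. specialize (Hu 1%nat). lra.
    + specialize (Hu (S (S N))). lra.
Qed.

(** The tangent line of [ln] at [m], summed over the terms. *)
Lemma sum_ln_le_tangent (u : nat -> R) (m : R) (N : nat) :
  (forall n, 0 < u n) -> 0 < m ->
  sum_n_m (fun n => ln (u n)) 1 N
  <= sum_n_m u 1 N / m + INR N * (ln m - 1).
Proof.
  intros Hu Hm. induction N as [|N IH].
  - rewrite !sum_from1_0. simpl. lra.
  - rewrite !sum_from1_S, S_INR.
    assert (H : ln (u (S N)) <= u (S N) / m - 1 + ln m).
    { assert (Hq : 0 < u (S N) / m) by now apply Rdiv_lt_0_compat.
      assert (H := exp_ineq1_le (ln (u (S N) / m))).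
      rewrite exp_ln in H by exact Hq.
      rewrite ln_div in H by auto. lra. }
    unfold Rdiv in *. lra.
Qed.

(** Inequality of arithmetic and geometric means, in logarithmic form: the
    tangent at the arithmetic mean itself makes the linear terms cancel. *)
Lemma sum_ln_le (u : nat -> R) (N : nat) :
  (forall n, 0 < u n) -> (0 < N)%nat ->
  sum_n_m (fun n => ln (u n)) 1 N <= INR N * ln (average u N).
Proof.
  intros Hu HN.
  assert (Hm := average_pos u N Hu HN).
  assert (H := sum_ln_le_tangent u _ N Hu Hm).
  rewrite <- (INR_mult_average u) in H by exact HN.
  replace (INR N * average u N / average u N) with (INR N) in H
    by (field; lra).
  lra.
Qed.

(** * Logarithms of the consecutive quotients *)

Definition log_ratio (a : nat -> R) (n : nat) : R :=
  ln (Rabs (a n / a (n - 1)%nat)).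

Section NonzeroTerms.

Variable a : nat -> R.
Hypothesis ha : forall n : nat, a n <> 0.

Lemma ratio_seq_exp (n : nat) : ratio_seq a n = exp (log_ratio a (S n)).
Proof.
  unfold ratio_seq, log_ratio.
  replace (S n - 1)%nat with n by lia.
  rewrite exp_ln.
  - unfold Rdiv. now rewrite Rabs_mult, Rabs_inv.
  - apply Rabs_pos_lt. unfold Rdiv.
    apply Rmult_integral_contrapositive_currified; [apply ha|].
    apply Rinv_neq_0_compat, ha.
Qed.

Lemma ln_abs_telescope (N : nat) :
  ln (Rabs (a N)) = ln (Rabs (a 0%nat)) + sum_n_m (log_ratio a) 1 N.
Proof.
  induction N as [|N IH].
  - rewrite sum_from1_0. ring.
  - rewrite sum_from1_S, <- Rplus_assoc, <- IH. unfold log_ratio.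
    replace (S N - 1)%nat with N by lia.
    rewrite Rabs_div by apply ha.
    rewrite ln_div by (apply Rabs_pos_lt, ha). ring.
Qed.

Lemma mean_seq_exp (p : R) (N : nat) :
  mean_seq p a N = exp (/ p * ln (average (fun n => exp (p * log_ratio a n)) N)).
Proof. reflexivity. Qed.

(** The inequality of means, applied to the [p]-th powers of the quotients: their
    geometric mean is determined by [a N] and [a 0] alone, by telescoping. *)
Lemma ln_abs_le_mean (p : R) (N : nat) :
  0 < p -> (0 < N)%nat ->
  ln (Rabs (a N)) <= ln (Rabs (a 0%nat)) + INR N * ln (mean_seq p a N).
Proof.
  intros hp HN.
  assert (H := sum_ln_le (fun n => exp (p * log_ratio a n)) N
                 (fun n => exp_pos _) HN).
  assert (E : sum_n_m (fun n => ln (exp (p * log_ratio a n))) 1 N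
              = p * sum_n_m (log_ratio a) 1 N :> R).
  { clear H HN. induction N as [|N IH].
    - rewrite !sum_from1_0. ring.
    - rewrite !sum_from1_S, IH, ln_exp. ring. }
  cbv beta in H. rewrite E in H.
  rewrite ln_abs_telescope, mean_seq_exp, ln_exp.
  apply Rplus_le_compat_l. apply (Rmult_le_reg_l p); [exact hp|].
  eapply Rle_trans; [exact H|]. right. field. lra.
Qed.

Lemma ex_series_of_mean_lt (p q : R) :
  0 < p -> q < 1 -> eventually (fun N => mean_seq p a N < q) -> ex_series a.
Proof.
  intros hp Hq1 [K HK].
  assert (Hq0 : 0 < q).
  { apply Rlt_trans with (mean_seq p a K); [apply exp_pos|]. apply HK; lia. }
  (* [S K] rather than [K]: the bound of [ln_abs_le_mean] needs an index [> 0] *)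
  apply (ex_series_incr_n a (S K)).
  apply (@ex_series_le R_AbsRing R_CompleteNormedModule) with
    (fun k => scal (Rabs (a 0%nat) * q ^ S K) (q ^ k)).
  - intros k. change (norm (a (S K + k)%nat)) with (Rabs (a (S K + k)%nat)).
    change (scal (Rabs (a 0%nat) * q ^ S K) (q ^ k))
      with (Rabs (a 0%nat) * q ^ S K * q ^ k).
    rewrite Rmult_assoc, <- pow_add.
    set (N := (S K + k)%nat).
    assert (HN := ln_abs_le_mean p N hp ltac:(unfold N; lia)).
    assert (H0 : 0 < Rabs (a 0%nat)) by apply Rabs_pos_lt, ha.
    assert (Hl : ln (mean_seq p a N) <= ln q).
    { left. apply ln_increasing; [apply exp_pos|].
      apply HK. unfold N; lia. }
    apply Rle_trans with (exp (ln (Rabs (a 0%nat)) + INR N * ln q)).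
    + rewrite <- (exp_ln (Rabs (a N))) at 1 by apply Rabs_pos_lt, ha.
      apply exp_le_mono. eapply Rle_trans; [exact HN|].
      apply Rplus_le_compat_l, Rmult_le_compat_l; [apply pos_INR|exact Hl].
    + right. rewrite exp_plus, exp_ln by exact H0.
      f_equal. now apply Rpower_pow.
  - apply (@ex_series_scal R_AbsRing R_NormedModule), ex_series_geom.
    rewrite Rabs_pos_eq; lra.
Qed.

Lemma log_ratio_lim (L : Rbar) :
  is_lim_seq (ratio_seq a) L ->
  exists x, Rbar_exp x = L /\ is_lim_seq (log_ratio a) x.
Proof.
  intros H.
  destruct (Rbar_exp_surj L) as [x Hx].
  { apply is_lim_seq_le with (fun _ => 0) (ratio_seq a);
      [|apply is_lim_seq_const|exact H].
    intros n. rewrite ratio_seq_exp. left. apply exp_pos. }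
  exists x. split; [exact Hx|].
  apply (proj2 (is_lim_seq_incr_1 (log_ratio a) x)).
  apply is_lim_seq_exp_inv. rewrite Hx.
  apply is_lim_seq_ext with (2 := H). exact ratio_seq_exp.
Qed.

Lemma root_seq_lim (x : Rbar) :
  is_lim_seq (log_ratio a) x -> is_lim_seq (root_seq a) (Rbar_exp x).
Proof.
  intros H. apply is_lim_seq_exp.
  apply is_lim_seq_ext with
    (fun N => ln (Rabs (a 0%nat)) * / INR N + average (log_ratio a) N).
  { intros N. rewrite (ln_abs_telescope N). unfold average, Rdiv. ring. }
  apply is_lim_seq_plus with (Finite 0) x.
  - replace (Finite 0)
      with (Rbar_mult (Finite (ln (Rabs (a 0%nat)))) (Rbar_inv p_infty))
      by (simpl; f_equal; ring).
    apply is_lim_seq_scal_l. apply is_lim_seq_inv; [apply is_lim_seq_INR|easy].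
  - now apply is_lim_seq_average.
  - destruct x as [r| |]; simpl; unfold is_Rbar_plus; simpl; try easy.
    now rewrite Rplus_0_l.
Qed.

(** Averages are taken of [exp (p * log_ratio a n)], not of [log_ratio a n], so
    the limit is transported through [exp], averaged there, and brought back. *)
Lemma mean_seq_lim (p : R) (x : Rbar) :
  0 < p -> is_lim_seq (log_ratio a) x ->
  is_lim_seq (mean_seq p a) (Rbar_exp x).
Proof.
  intros hp H. apply is_lim_seq_exp.
  rewrite <- (Rbar_mult_inv_l p x hp).
  apply is_lim_seq_scal_l, is_lim_seq_exp_inv.
  (* [exp] cancels [ln] only from [N = 1] on: the empty average is 0 *)
  apply is_lim_seq_ext_loc with
    (average (fun n => exp (p * log_ratio a n))).
  { exists 1%nat. intros N HN. symmetry. apply exp_ln.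
    apply average_pos; [intros; apply exp_pos|lia]. }
  apply is_lim_seq_average, is_lim_seq_exp.
  now apply is_lim_seq_scal_l.
Qed.

End NonzeroTerms.

(** * Convergence and equality of the limits *)

Theorem theorem2p5 (a : nat -> R) (p : R)
  (ha : forall n : nat, a n <> 0) (hp : 0 < p) :
  (ex_lim_seq (mean_seq p a) -> Rbar_lt (rho_mean p a) (Finite 1) ->
   ex_series a)
  /\
  (ex_lim_seq (ratio_seq a) ->
   ex_lim_seq (mean_seq p a) /\ ex_lim_seq (root_seq a) /\
   rho_mean p a = rho_root a /\ rho_root a = rho_ratio a).
Proof.
  split.
  - intros Hex Hlt. apply Lim_seq_correct in Hex.
    fold (rho_mean p a) in Hex. apply is_lim_seq_spec in Hex.
    destruct (rho_mean p a) as [l| |]; simpl in *.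
    + apply (ex_series_of_mean_lt a ha p ((1 + l) / 2)); [exact hp|lra|].
      assert (Heps : 0 < (1 - l) / 2) by lra.
      destruct (Hex (mkposreal _ Heps)) as [K HK].
      exists K. intros N HN. specialize (HK N HN). simpl in HK.
      apply Rabs_def2 in HK. lra.
    + contradiction.
    + apply (ex_series_of_mean_lt a ha p 0); [exact hp|lra|apply Hex].
  - intros [L HL].
    destruct (log_ratio_lim a ha L HL) as [x [Hx Ht]].
    assert (Hroot := root_seq_lim a ha x Ht).
    assert (Hmean := mean_seq_lim a p x hp Ht).
    rewrite Hx in Hroot, Hmean.
    split; [now exists L|]. split; [now exists L|].
    unfold rho_mean, rho_root, rho_ratio.
    now rewrite (is_lim_seq_unique _ _ Hroot), (is_lim_seq_unique _ _ Hmean),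
      (is_lim_seq_unique _ _ HL).
Qed.
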